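(* For every integer $N \ge 0$, the equality negation task for two processes is not solvable in the $N$-layer message-passing model; that is, there is no morphism of simplicial models $\delta : \mathcal{I}[\mathcal{MP}_N] \to \mathcal{O}$ such that $\pi \circ \delta = \pi$, where $\pi : \mathcal{I}[\mathcal{MP}_N]\to\mathcal{I}$ and $\pi:\mathcal{O}\to\mathcal{I}$ are the projections described in the context.
   Context: Simplicial models. Fix a finite set $\mathrm{Ag}$ of agents. A simplicial complex is a family $C$ of non-empty finite subsets (simplices) of a vertex set closed under taking non-empty subsets; facets (also called worlds) are the maximal simplices. A chromatic simplicial complex comes with a coloring $\chi$ from vertices to $\mathrm{Ag}$ such that the vertices of each simplex have distinct colors. A simplicial model $\mathcal{M}=\langle C,\chi,\ell\rangle$ is a pure chromatic simplicial complex of dimension $|\mathrm{Ag}|-1$ together with a labeling $\ell$ assigning to each vertex $v$ a set of atomic propositions concerning agent $\chi(v)$. For a facet $X$, $\ell(X)=\bigcup_{v\in X}\ell(v)$. Formulas: $\varphi ::= p \mid \neg\varphi \mid \varphi\wedge\varphi \mid K_a\varphi$; semantics: $\mathcal{M},X\models p$ iff $p\in\ell(X)$; negation and conjunction as usual; $\mathcal{M},X\models K_a\varphi$ iff $\mathcal{M},Y\models\varphi$ for every facet $Y$ with $a\in\chi(X\cap Y)$. A morphism of simplicial models is a map on vertices sending simplices to simplices and preserving $\chi$ and $\ell$. Action models and product update. An action model $\mathcal{A}=\langle T,\sim,\mathsf{pre}\rangle$ consists of a set $T$ of actions, an equivalence relation $\sim_a$ on $T$ for each agent $a$, and a precondition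 formula $\mathsf{pre}(t)$ for each $t\in T$. The product update $\mathcal{M}[\mathcal{A}]$ has as vertices the pairs $(v,E)$ with $v$ a vertex of $C$ and $E$ an equivalence class of $\sim_{\chi(v)}$ such that some facet $X\ni v$ and some $t\in E$ satisfy $\mathcal{M},X\models\mathsf{pre}(t)$; its facets are the sets $\{(v,[t]_{\chi(v)}) : v\in X\}$ for facets $X$ of $C$ and actions $t$ with $\mathcal{M},X\models\mathsf{pre}(t)$ (simplices are their non-empty subsets); color and labeling of $(v,E)$ are those of $v$. The projection $\pi:\mathcal{M}[\mathcal{A}]\to\mathcal{M}$ is $(v,E)\mapsto v$. Equality negation. $\mathrm{Ag}=\{B,W\}$; atomic propositions $\mathrm{in}_p^i$ ($p\in\mathrm{Ag}$, $i\in\{0,1,2\}$), meaning ''process $p$ has input $i$''. The input model $\mathcal{I}$ has vertices $(p,i)\in\mathrm{Ag}\times\{0,1,2\}$, facets all $\{(B,i),(W,j)\}$ for $i,j\in\{0,1,2\}$, coloring $\chi(p,i)=p$, labeling $\ell(p,i)=\{\mathrm{in}_p^i\}$. The output model $\mathcal{O}$ (the product update of $\mathcal{I}$ by the task action model with actions $(d_B,d_W)\in\{0,1\}^2$, $(d_B,d_W)\sim_p(d_B',d_W')$ iff $d_p=d_p'$, and $\mathsf{pre}(d_B,d_W)$ true exactly on input facets with different inputs if $d_B=d_W$ and with equal inputs otherwise) has vertices $(p,i,d)$ with $p\in\mathrm{Ag}$, $i\in\{0,1,2\}$, $d\in\{0,1\}$, facets $\{(B,i,d_B),(W,j,d_W)\}$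 where $i=j \iff d_B\neq d_W$, coloring $p$, labeling $\{\mathrm{in}_p^i\}$, and projection $\pi(p,i,d)=(p,i)$. $N$-layer message-passing action model $\mathcal{MP}_N=\langle T,\sim,\mathsf{pre}\rangle$ over $\mathcal{I}$: $L_N$ is the set of words of length $N$ over $\{\bot,B,W\}$; $T=L_N\times\mathcal{F}(\mathcal{I})$ where $\mathcal{F}(\mathcal{I})$ is the set of facets of $\mathcal{I}$; $\mathsf{pre}(\alpha,X)=\bigwedge_{a\in\mathrm{Ag}}\mathrm{in}_a^{X_a}$ where $X_a$ is $a$'s input in $X$. For $N=0$: $(\varepsilon,X)\sim_a(\varepsilon,Y)$ iff $X_a=Y_a$. For $\alpha,\beta\in L_N$, $p,q\in\{\bot,B,W\}$: $(\alpha p,X)\sim_B(\beta q,Y)$ iff either $p=q=W$ and $(\alpha,X)\sim_B(\beta,Y)$, or $p,q\in\{\bot,B\}$, $X=Y$ and $\alpha=\beta$; $\sim_W$ is defined symmetrically with the roles of $B$ and $W$ exchanged. *)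

(* Defs.v *)
From HB Require Import structures.
From mathcomp Require Import all_boot.
Set Implicit Arguments.
Unset Strict Implicit.
Unset Printing Implicit Defensive.

Definition facets (V : finType) (C : {set {set V}}) : {set {set V}} :=
  [set X | maxset [pred Y | Y \in C] X].

(* [owner p] is the agent that the atomic proposition [p] concerns. *)
Record simplicial_model (Ag At : finType) (owner : At -> Ag) :=
  SimplicialModel {
    vertex : finType;
    simplices : {set {set vertex}};
    color : vertex -> Ag;
    label : vertex -> {set At};
    simplex_neq0 : forall X, X \in simplices -> X != set0;
    simplex_sub : forall X Y : {set vertex},
      X \in simplices -> Y \subset X -> Y != set0 -> Y \in simplices;
    simplex_chromatic : forall X,
      X \in simplices -> {in X &, injective color};
    facet_card : forall X, X \in facets simplices -> #|X| = #|Ag|;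
    label_owner : forall v p, p \in label v -> owner p = color v
  }.

Arguments simplices {Ag At owner} s.
Arguments color {Ag At owner s} v.
Arguments label {Ag At owner s} v.

Definition worlds (Ag At : finType) (owner : At -> Ag)
  (M : simplicial_model owner) : {set {set vertex M}} := facets (simplices M).

Definition world_label (Ag At : finType) (owner : At -> Ag)
  (M : simplicial_model owner) (X : {set vertex M}) : {set At} :=
  \bigcup_(v in X) label v.

Definition nonempty_faces (V : finType) (F : {set {set V}}) : {set {set V}} :=
  [set Z | (Z != set0) && [exists X in F, Z \subset X]].

Section FromFacets.
Variables (Ag At : finType) (owner : At -> Ag) (V : finType).
Variables (F : {set {set V}}) (col : V -> Ag) (lab : V -> {set At}).
Hypothesis F_chromatic : forall X, X \in F -> {in X &, injective col}.
Hypothesis F_card : forall X, X \in F -> #|X| = #|Ag|.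
Hypothesis lab_owner : forall v p, p \in lab v -> owner p = col v.

Lemma nonempty_faces_neq0 Z : Z \in nonempty_faces F -> Z != set0.
Proof. by rewrite inE => /andP[]. Qed.

Lemma nonempty_faces_sub (Z Y : {set V}) :
  Z \in nonempty_faces F -> Y \subset Z -> Y != set0 -> Y \in nonempty_faces F.
Proof.
rewrite !inE => /andP[_ /exists_inP[X FX ZX]] YZ ->.
by apply/exists_inP; exists X => //; apply: subset_trans ZX.
Qed.

Lemma nonempty_faces_chromatic Z :
  Z \in nonempty_faces F -> {in Z &, injective col}.
Proof.
rewrite inE => /andP[_ /exists_inP[X FX /subsetP ZX]] u v Zu Zv.
by apply: (F_chromatic FX); apply: ZX.
Qed.

Lemma facet_nonempty_faces Z : Z \in facets (nonempty_faces F) -> Z \in F.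
Proof.
rewrite inE => /maxsetP[/= FZ maxZ]; move: (FZ).
rewrite inE => /andP[Z0 /exists_inP[X FX ZX]].
have XZ : X = Z.
  apply: maxZ => //=; rewrite inE; apply/andP; split.
    by apply: contraNneq Z0 => X0; rewrite X0 subset0 in ZX.
  by apply/exists_inP; exists X.
by rewrite -XZ.
Qed.

Lemma nonempty_faces_card Z : Z \in facets (nonempty_faces F) -> #|Z| = #|Ag|.
Proof. by move/facet_nonempty_faces/F_card. Qed.

Definition model_of_facets : simplicial_model owner :=
  @SimplicialModel Ag At owner V (nonempty_faces F) col lab
    nonempty_faces_neq0 nonempty_faces_sub nonempty_faces_chromatic
    nonempty_faces_card lab_owner.

Lemma worlds_model_of_facets : set0 \notin F -> worlds model_of_facets = F.
Proof.
move=> F0; apply/setP=> Z; apply/idP/idP; first exact: facet_nonempty_faces.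
move=> FZ; rewrite inE; apply/maxsetP; split => /=.
  rewrite inE; apply/andP; split; first by apply: contraNneq F0 => <-.
  by apply/exists_inP; exists Z.
move=> Y; rewrite inE => /andP[_ /exists_inP[X FX YX]] ZY.
by apply/esym/eqP; rewrite eqEcard ZY (F_card FZ) -(F_card FX) subset_leq_card.
Qed.

End FromFacets.

Inductive formula (Ag At : Type) : Type :=
| Atom of At
| Neg of formula Ag At
| And of formula Ag At & formula Ag At
| Know of Ag & formula Ag At.

Arguments Atom {Ag At} p.
Arguments Neg {Ag At} f.
Arguments And {Ag At} f g.
Arguments Know {Ag At} a f.

Fixpoint sat (Ag At : finType) (owner : At -> Ag) (M : simplicial_model owner)
    (X : {set vertex M}) (f : formula Ag At) : bool :=
  match f with
  | Atom p => p \in world_label X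
  | Neg g => ~~ sat X g
  | And g h => sat X g && sat X h
  | Know a g =>
      [forall Y in worlds M, (a \in color @: (X :&: Y)) ==> sat Y g]
  end.

Record morphism (Ag At : finType) (owner : At -> Ag)
    (M N : simplicial_model owner) := Morphism {
  morphism_fun :> vertex M -> vertex N;
  morphism_simplex : forall X,
    X \in simplices M -> morphism_fun @: X \in simplices N;
  morphism_color : forall v, color (morphism_fun v) = color v;
  morphism_label : forall v, label (morphism_fun v) = label v
}.

Record action_model (Ag At : finType) := ActionModel {
  action : finType;
  indist : Ag -> rel action;
  indist_equiv : forall a, equivalence_rel (indist a);
  precond : action -> formula Ag At
}.

Arguments indist {Ag At A} a _ _ : rename.
Arguments precond {Ag At A} t : rename.

Definition action_class (Ag At : finType) (A : action_model Ag At) (a : Ag)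
  (t : action A) : {set action A} := [set s | indist a t s].

Section ProductUpdate.
Variables (Ag At : finType) (owner : At -> Ag).
Variables (M : simplicial_model owner) (A : action_model Ag At).

Definition product_vertex_pred (x : vertex M * {set action A}) : bool :=
  let: (v, E) := x in
  [exists t, E == action_class (color v) t] &&
  [exists X in worlds M, exists t in E, (v \in X) && sat X (precond t)].

Definition product_vertex : finType :=
  {x : vertex M * {set action A} | product_vertex_pred x}.

Definition product_facet (X : {set vertex M}) (t : action A) :
    {set product_vertex} :=
  [set u | val u \in [set (v, action_class (color v) t) | v in X]].

Definition product_facets : {set {set product_vertex}} :=
  [set product_facet X t | X in worlds M, t in {: action A} & sat X (precond t)].

Definition product_proj (u : product_vertex) : vertex M := (val u).1.
Definition product_color (u : product_vertex) : Ag := color (product_proj u).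
Definition product_label (u : product_vertex) : {set At} :=
  label (product_proj u).

Lemma product_vertex_inj (u w : product_vertex) :
  (val u).1 = (val w).1 -> (val u).2 = (val w).2 -> u = w.
Proof.
by move=> E1 E2; apply: val_inj; case: (val u) (val w) E1 E2 => ? ? [? ?] /= -> ->.
Qed.

Lemma action_class_refl a (t : action A) : t \in action_class a t.
Proof. by rewrite inE; case: (indist_equiv a t t t). Qed.

Lemma product_vertexP X t v :
  X \in worlds M -> sat X (precond t) -> v \in X ->
  product_vertex_pred (v, action_class (color v) t).
Proof.
move=> MX Xt Xv; apply/andP; split; first by apply/existsP; exists t.
apply/exists_inP; exists X => //; apply/exists_inP; exists t.
  exact: action_class_refl.
by rewrite Xv.
Qed.

Lemma product_facet_image X t :
  X \in worlds M -> sat X (precond t) ->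
  val @: product_facet X t = [set (v, action_class (color v) t) | v in X].
Proof.
move=> MX Xt; apply/setP=> x; apply/imsetP/idP => [[u]|Xx].
  by rewrite inE => ? ->.
have Px : product_vertex_pred x.
  by case/imsetP: Xx => v Xv ->; exact: (product_vertexP MX Xt Xv).
by exists (Sub x Px); rewrite ?inE ?SubK.
Qed.

Lemma product_facet_card Z : Z \in product_facets -> #|Z| = #|Ag|.
Proof.
case/imset2P=> X t MX; rewrite inE => /andP[_ Xt] ->.
rewrite -(card_imset _ val_inj) product_facet_image // card_imset.
  exact: facet_card MX.
by move=> u v [].
Qed.

Lemma world_chromatic X : X \in worlds M -> {in X &, injective (@color _ _ _ M)}.
Proof.
by rewrite inE => /maxsetP[/= MX _]; apply: simplex_chromatic.
Qed.

Lemma product_facet_chromatic Z :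
  Z \in product_facets -> {in Z &, injective product_color}.
Proof.
case/imset2P=> X t MX _ -> u v; rewrite !inE.
case/imsetP=> u0 Xu Du; case/imsetP=> v0 Xv Dv.
rewrite /product_color /product_proj Du Dv /= => Ec.
by apply: val_inj; rewrite Du Dv (world_chromatic MX Xu Xv Ec).
Qed.

Lemma product_label_owner u p : p \in product_label u -> owner p = product_color u.
Proof. exact: label_owner. Qed.

Definition product_update : simplicial_model owner :=
  model_of_facets product_facet_chromatic product_facet_card product_label_owner.

Lemma worlds_product : worlds product_update = product_facets.
Proof.
apply: worlds_model_of_facets; apply/negP=> P0.
have card0 := product_facet_card P0; rewrite cards0 in card0.
case/imset2P: P0 => X t MX _ _; have := facet_card MX.
rewrite -card0 => /eqP; rewrite cards_eq0 => /eqP X0.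
move: MX; rewrite inE => /maxsetP[/= MX _].
by have := simplex_neq0 MX; rewrite X0 eqxx.
Qed.

End ProductUpdate.

Arguments product_proj {Ag At owner M A} u.

Variant process := B | W.

Definition bool_of_process a := if a is B then true else false.
Definition process_of_bool b := if b then B else W.
Lemma bool_of_processK : cancel bool_of_process process_of_bool.
Proof. by case. Qed.
HB.instance Definition _ := Finite.copy process (can_type bool_of_processK).

Lemma card_process : #|{: process}| = 2.
Proof.
rewrite -card_bool; apply: (bij_eq_card (f := bool_of_process)).
by exists process_of_bool => // -[].
Qed.

(* The atom [(p, i)] is in_p^i. *)
Definition input_atom : finType := (process * 'I_3)%type.
Definition input_owner (p : input_atom) : process := p.1.

Definition input_vertex : finType := (process * 'I_3)%type.

Definition input_facets : {set {set input_vertex}} :=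
  [set [set (B, i); (W, j)] | i : 'I_3, j : 'I_3].

Definition input_color (v : input_vertex) : process := v.1.
Definition input_label (v : input_vertex) : {set input_atom} :=
  [set (v.1, v.2)].

Lemma input_facet_chromatic X :
  X \in input_facets -> {in X &, injective input_color}.
Proof.
case/imset2P=> i j _ _ -> u v; rewrite !inE.
by case/orP=> /eqP -> /orP[] /eqP ->.
Qed.

Lemma input_facet_card X : X \in input_facets -> #|X| = #|{: process}|.
Proof. by case/imset2P=> i j _ _ ->; rewrite cards2 card_process. Qed.

Lemma input_label_owner v p : p \in input_label v -> input_owner p = input_color v.
Proof. by rewrite inE => /eqP ->. Qed.

Definition input_model : simplicial_model input_owner :=
  model_of_facets input_facet_chromatic input_facet_card input_label_owner.

Definition output_vertex : finType := (process * 'I_3 * bool)%type.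

Definition output_facets : {set {set output_vertex}} :=
  [set [set (B, x.1, x.2); (W, y.1, y.2)]
     | x in {: 'I_3 * bool}, y in {: 'I_3 * bool} & (x.1 == y.1) == (x.2 != y.2)].

Definition output_color (v : output_vertex) : process := v.1.1.
Definition output_label (v : output_vertex) : {set input_atom} :=
  [set (v.1.1, v.1.2)].

Lemma output_facet_chromatic X :
  X \in output_facets -> {in X &, injective output_color}.
Proof.
case/imset2P=> x y _ _ -> u v; rewrite !inE.
by case/orP=> /eqP -> /orP[] /eqP ->.
Qed.

Lemma output_facet_card X : X \in output_facets -> #|X| = #|{: process}|.
Proof. by case/imset2P=> x y _ _ ->; rewrite cards2 card_process. Qed.

Lemma output_label_owner v p :
  p \in output_label v -> input_owner p = output_color v.
Proof. by rewrite inE => /eqP ->. Qed.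

Definition output_model : simplicial_model input_owner :=
  model_of_facets output_facet_chromatic output_facet_card output_label_owner.

Definition output_proj (v : vertex output_model) : vertex input_model := v.1.

Definition in_ (a : process) (i : 'I_3) : formula process input_atom :=
  Atom (a, i).

Definition Or (Ag At : Type) (f g : formula Ag At) : formula Ag At :=
  Neg (And (Neg f) (Neg g)).

Lemma sat_Or (Ag At : finType) (owner : At -> Ag) (M : simplicial_model owner)
  (X : {set vertex M}) f g : sat X (Or f g) = sat X f || sat X g.
Proof. by rewrite /= negb_and !negbK. Qed.

Definition equal_inputs : formula process input_atom :=
  let same i := And (in_ B i) (in_ W i) in
  Or (same (inord 0)) (Or (same (inord 1)) (same (inord 2))).

(* The action [t] is the pair of decisions (d_B, d_W). *)
Definition decision (a : process) (t : bool * bool) : bool :=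
  if a is B then t.1 else t.2.

Definition task_indist (a : process) (s t : bool * bool) : bool :=
  decision a s == decision a t.

Lemma task_indist_equiv a : equivalence_rel (task_indist a).
Proof. by move=> s t u; split; rewrite /task_indist // => /eqP ->. Qed.

Definition task_precond (t : bool * bool) : formula process input_atom :=
  if t.1 == t.2 then Neg equal_inputs else equal_inputs.

Definition equality_negation : action_model process input_atom :=
  @ActionModel process input_atom (bool * bool)%type task_indist
    task_indist_equiv task_precond.

Lemma worlds_input : worlds input_model = input_facets.
Proof.
apply: worlds_model_of_facets; apply/negP=> /input_facet_card.
by rewrite cards0 card_process.
Qed.

Lemma sat_in (i j k : 'I_3) a :
  @sat _ _ _ input_model [set (B, i); (W, j)] (in_ a k) =
    (k == if a is B then i else j).
Proof.
rewrite /= /world_label; apply/bigcupP/eqP => [[[b l]]|].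
  by rewrite !inE => /orP[] /eqP[-> ->] /eqP[-> ->].
by case: a => ->; [exists (B, i) | exists (W, j)]; rewrite !inE ?eqxx ?orbT.
Qed.

Lemma sat_equal_inputs (i j : 'I_3) :
  @sat _ _ _ input_model [set (B, i); (W, j)] equal_inputs = (i == j).
Proof.
have E k : @sat _ _ _ input_model [set (B, i); (W, j)]
    (And (in_ B k) (in_ W k)) = (k == i) && (k == j).
  by rewrite -(sat_in i j k B) -(sat_in i j k W).
rewrite !sat_Or !E -!val_eqE /= !inordK //.
by case: i {E} => [[|[|[]]] //= ?]; case: j => [[|[|[]]] //= ?].
Qed.

Lemma sat_task_precond (i j : 'I_3) t :
  @sat _ _ _ input_model [set (B, i); (W, j)] (task_precond t) =
    ((i == j) == (t.1 != t.2)).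
Proof.
have := sat_equal_inputs i j; rewrite /task_precond.
by case: (t.1 == t.2) => //= ->; case: (i == j).
Qed.

Definition output_iso (u : vertex (product_update input_model equality_negation)) :
    vertex output_model :=
  ((val u).1, [exists t in (val u).2, decision (val u).1.1 t]).

Lemma class_decision a t :
  [exists s in @action_class _ _ equality_negation a t, decision a s]
    = decision a t.
Proof.
apply/exists_inP/idP => [[s]|at1]; last by exists t; rewrite ?inE /= /task_indist.
by rewrite inE /= /task_indist => /eqP ->.
Qed.

Lemma output_iso_inj : injective output_iso.
Proof.
case=> [[v E] /= Pu]; case=> [[w F] /= Pw] [Ev]; move: Ev Pu Pw => /= <- Pu Pw.
have [/existsP[s /eqP Es] _] := andP Pu; have [/existsP[t /eqP Et] _] := andP Pw.
rewrite {1}Es {1}Et !class_decision => Est.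
apply: (@product_vertex_inj _ _ _ input_model equality_negation) => //=.
rewrite Es Et; apply/setP=> r.
by rewrite !inE /= /task_indist Est.
Qed.

Lemma output_iso_facet (i j : 'I_3) (t : bool * bool) :
  (i == j) == (t.1 != t.2) ->
  output_iso @: @product_facet _ _ _ input_model equality_negation
      [set (B, i); (W, j)] t
  = [set (B, i, t.1); (W, j, t.2)].
Proof.
move=> Ht.
pose h (x : input_vertex * {set bool * bool}) : output_vertex :=
  (x.1, [exists s in x.2, decision x.1.1 s]).
have im := @product_facet_image _ _ _ input_model equality_negation
  [set (B, i); (W, j)] t.
rewrite (imset_comp h) im.
- by rewrite -imset_comp imsetU1 imset_set1 /= /h /= !class_decision.
- by rewrite worlds_input; apply/imset2P; exists i j.
- by rewrite /= sat_task_precond.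
Qed.

Lemma output_iso_facets :
  [set output_iso @: (Z : {set product_vertex input_model equality_negation})
     | Z in product_facets input_model equality_negation]
  = output_facets.
Proof.
apply/setP=> Z; apply/imsetP/imset2P => [[Y]|[x y _]].
  case/imset2P=> X t; rewrite worlds_input => /imset2P[i j _ _ ->].
  rewrite inE /= sat_task_precond => Ht -> ->.
  by exists (i, t.1) (j, t.2); rewrite ?inE // output_iso_facet.
rewrite inE /= => Hxy ->.
exists (@product_facet _ _ _ input_model equality_negation
          [set (B, x.1); (W, y.1)] (x.2, y.2)); last by rewrite output_iso_facet.
apply/imset2P; exists [set (B, x.1); (W, y.1)] (x.2, y.2) => //.
  by rewrite worlds_input; apply/imset2P; exists x.1 y.1.
by rewrite inE /= sat_task_precond.
Qed.

Lemma output_iso_surj x : exists u, output_iso u = x.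
Proof.
have [Z FZ Zx] : exists2 Z, Z \in output_facets & x \in Z.
  case: x => [[[] i] d].
    exists [set (B, i, d); (W, i, ~~ d)]; rewrite ?inE ?eqxx //.
    by apply/imset2P; exists (i, d) (i, ~~ d); rewrite ?inE //= eqxx; case: d.
  exists [set (B, i, ~~ d); (W, i, d)]; rewrite ?inE ?eqxx ?orbT //.
  by apply/imset2P; exists (i, ~~ d) (i, d); rewrite ?inE //= eqxx; case: d.
move: FZ Zx; rewrite -output_iso_facets => /imsetP[Y _ ->] /imsetP[u _ ->].
by exists u.
Qed.

(* [output_model] is, up to renaming of vertices over [input_model], the product
   update of [input_model] by [equality_negation]. *)
Lemma output_model_product :
  [/\ bijective output_iso,
      forall Z : {set vertex (product_update input_model equality_negation)},
        (output_iso @: Z \in simplices output_model)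
        = (Z \in simplices (product_update input_model equality_negation)),
      forall u, color (output_iso u) = color u,
      forall u, label (output_iso u) = label u &
      forall u, output_proj (output_iso u) = product_proj u].
Proof.
split=> //.
- have surj x : exists u, output_iso u == x.
    by have [u <-] := output_iso_surj x; exists u.
  exists (fun x => xchoose (surj x)) => x.
    by apply: output_iso_inj; apply/eqP/(xchooseP (surj _)).
  by apply/eqP/(xchooseP (surj x)).
- move=> Z; rewrite !inE imset_eq0; congr (_ && _).
  apply/exists_inP/exists_inP => [[Y]|[X FX ZX]].
    rewrite -output_iso_facets => /imsetP[X FX ->] ZX; exists X => //.
    apply/subsetP=> u Zu; have := subsetP ZX _ (imset_f output_iso Zu).
    by rewrite mem_imset //; apply: output_iso_inj.
  exists (output_iso @: X); last exact: imsetS.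
  by rewrite -output_iso_facets imset_f.
Qed.

Definition other (a : process) : process := if a is B then W else B.

Definition input_facet : finType := {X : {set input_vertex} | X \in worlds input_model}.

(* Every facet has exactly one [i] with [(a, i) \in X], so the default value is
   never used. *)
Definition input_of (a : process) (X : input_facet) : 'I_3 :=
  odflt ord0 [pick i | (a, i) \in val X].

(* The letter [None] is the symbol bottom: no message is lost. The letter
   [Some a] means that the message sent by [a] is lost. *)
Definition letter : finType := option process.

(* [u] and [v] are reversed words: their head is the last layer. The defining
   equations on words are [mp_indist0] and [mp_indistS] below. *)
Fixpoint mp_indist_rev (a : process) (u v : seq letter) (X Y : input_facet)
    : bool :=
  match u, v with
  | [::], [::] => input_of a X == input_of a Y
  | p :: u', q :: v' =>
      [&& p == Some (other a), q == Some (other a) & mp_indist_rev a u' v' X Y]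
      || [&& p \in [:: None; Some a], q \in [:: None; Some a], X == Y & u' == v']
  | _, _ => false
  end.

Definition mp_action (N : nat) : finType := (N.-tuple letter * input_facet)%type.

Definition mp_indist (N : nat) (a : process) (s t : mp_action N) : bool :=
  mp_indist_rev a (rev s.1) (rev t.1) s.2 t.2.

Lemma mp_indist0 a (X Y : input_facet) :
  mp_indist a ([tuple], X) ([tuple], Y) = (input_of a X == input_of a Y).
Proof. by []. Qed.

Lemma mp_indistS N a (al be : N.-tuple letter) p q X Y :
  mp_indist a ([tuple of rcons al p], X) ([tuple of rcons be q], Y) =
    [&& p == Some (other a), q == Some (other a) & mp_indist a (al, X) (be, Y)]
    || [&& p \in [:: None; Some a], q \in [:: None; Some a], X == Y & al == be].
Proof. by rewrite /mp_indist /= !rev_rcons /= (can_eq revK). Qed.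

Lemma mp_indist_rev_refl a u X : mp_indist_rev a u u X X.
Proof. by elim: u => //= p u ->; rewrite !eqxx; case: a; case: p => [[]|]. Qed.

Lemma mp_indist_rev_sym a u v X Y :
  mp_indist_rev a u v X Y = mp_indist_rev a v u Y X.
Proof.
elim: u v => [|p u IH] [|q v] //=.
by rewrite IH (eq_sym X) (eq_sym u) [X in X || _]andbCA [X in _ || X]andbCA.
Qed.

Lemma mp_indist_rev_trans a v u w X Y Z :
  mp_indist_rev a u v X Y -> mp_indist_rev a v w Y Z -> mp_indist_rev a u w X Z.
Proof.
elim: v u w => [|q v IH] [|p u] [|r w] //=; first by move=> /eqP ->.
case/orP=> [/and3P[-> /eqP -> uv] | /and4P[pa qa /eqP -> /eqP ->]].
  by case/orP=> [/and3P[_ -> vw]|]; [rewrite (IH _ _ uv vw) | case: (a)].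
case/orP=> [/and3P[/eqP qo _ _] | /and4P[_ -> -> ->]].
  by move: qa; rewrite qo; case: (a).
by rewrite pa orbT.
Qed.

Lemma mp_indist_equiv N a : equivalence_rel (@mp_indist N a).
Proof.
move=> s t w; split=> [|st]; first exact: mp_indist_rev_refl.
apply/idP/idP; last exact: mp_indist_rev_trans.
by apply: mp_indist_rev_trans; rewrite mp_indist_rev_sym.
Qed.

Definition mp_precond (N : nat) (t : mp_action N) : formula process input_atom :=
  And (in_ B (input_of B t.2)) (in_ W (input_of W t.2)).

Definition message_passing (N : nat) : action_model process input_atom :=
  @ActionModel process input_atom (mp_action N) (@mp_indist N)
    (@mp_indist_equiv N) (@mp_precond N).

(* Main.v *)
Require Import Defs.
From mathcomp Require Import all_boot.

Set Implicit Arguments.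
Unset Strict Implicit.
Unset Printing Implicit Defensive.

(** The protocol graph is K_{3,3} with every edge subdivided into 3^N edges. A
    solution is constant along a subdivided edge with distinct inputs, and takes
    opposite values at the ends of one with equal inputs, since it changes on
    each of an odd number of edges. Shrinking each layer to its two extreme
    views thus turns a solution for N + 1 layers into one for N layers. Without
    layers, the path (B,0) - (W,1) - (B,2) - (W,0) forces the decisions of (B,0)
    and (W,0) to be equal, although equal inputs require distinct decisions. *)

Lemma input_facetP (X : input_facet) :
  val X = [set (B, input_of B X); (W, input_of W X)].
Proof.
have [i [j EX]] : exists i j, val X = [set (B, i); (W, j)].
  case: X => Z /=; rewrite worlds_input => /imset2P[i j _ _ ->].
  by exists i, j.
rewrite /input_of EX; case: pickP => [k|/(_ i)]; rewrite !inE ?eqxx //=.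
case/orP=> /eqP[] // ->; case: pickP => [l|/(_ j)]; rewrite !inE ?eqxx ?orbT //=.
by move=> /eqP[->].
Qed.

Lemma input_of_mem a (X : input_facet) : (a, input_of a X) \in val X.
Proof. by rewrite input_facetP; case: a; rewrite !inE eqxx ?orbT. Qed.

Lemma input_facet_exists (i j : 'I_3) :
  exists X : input_facet, input_of B X = i /\ input_of W X = j.
Proof.
have MX : [set (B, i); (W, j)] \in worlds input_model.
  by rewrite worlds_input; apply/imset2P; exists i j.
pose X : input_facet := exist _ [set (B, i); (W, j)] MX.
exists X; have := input_of_mem B X; have := input_of_mem W X.
by rewrite !inE /= orbF => /eqP[->] /eqP[->].
Qed.

(** Makes every action executable at the input facet it carries, so that each action yields a facet
    of the protocol complex. *)
Lemma sat_mp_precond N (t : mp_action N) :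
  @sat _ _ _ input_model (val t.2) (mp_precond t).
Proof.
have satE a : @sat _ _ _ input_model (val t.2) (in_ a (input_of a t.2)).
  by rewrite [val _]input_facetP sat_in; case: a.
by apply/andP; split; apply: satE.
Qed.

(** A solution freed from simplicial models: decisions depend only on the agent's view, and the sum
    modulo 2 encodes that they differ exactly when the inputs are equal. *)
Definition decides N (D : process -> mp_action N -> bool) :=
  (forall a s t, mp_indist a s t -> D a s = D a t) /\
  (forall t, D W t = (input_of B t.2 == input_of W t.2) (+) D B t).

Lemma decides_shrink N (D : process -> mp_action N.+1 -> bool) :
  decides D ->
  decides (fun a (t : mp_action N) =>
             (* The extreme view: [a] receives nothing in the last layer, hence learns nothing
                new. *)
             D a ([tuple of rcons t.1 (Some (other a))], t.2)).
Proof.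
case=> indD conD; split=> [a [al X] [be Y] st /=|[al X] /=].
  by apply: indD; rewrite mp_indistS !eqxx st.
pose E p : mp_action N.+1 := ([tuple of rcons al p], X).
have EB : D B (E None) = D B (E (Some B)).
  by apply: indD; rewrite mp_indistS !inE !eqxx orbT.
have EW : D W (E (Some W)) = D W (E None).
  by apply: indD; rewrite mp_indistS !inE !eqxx orbT.
(* The three edges of the path replacing an edge of the previous layer; [EB] and [EW] identify its
   two inner vertices. Adding the same bit three times amounts to adding it once. *)
have := conD (E (Some W)); have := conD (E None); have := conD (E (Some B)).
rewrite EW /= => -> ->.
by rewrite -EB; case: (_ == _); case: (D B _).
Qed.

Lemma decides0F (D : process -> mp_action 0 -> bool) : ~ decides D.
Proof.
case=> indD conD.
pose E X : mp_action 0 := ([tuple], X).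
pose i0 : 'I_3 := inord 0; pose i1 : 'I_3 := inord 1; pose i2 : 'I_3 := inord 2.
(* [X01], [X21] and [X20] are the edges of the path; [X00] joins its ends. *)
have [X00 [B00 W00]] := input_facet_exists i0 i0.
have [X01 [B01 W01]] := input_facet_exists i0 i1.
have [X21 [B21 W21]] := input_facet_exists i2 i1.
have [X20 [B20 W20]] := input_facet_exists i2 i0.
have same a X Y : input_of a X = input_of a Y -> D a (E X) = D a (E Y).
  by move=> XY; apply: indD; rewrite mp_indist0 XY.
have n01 : (i0 == i1) = false by rewrite -val_eqE /= !inordK.
have n21 : (i2 == i1) = false by rewrite -val_eqE /= !inordK.
have n20 : (i2 == i0) = false by rewrite -val_eqE /= !inordK.
have := conD (E X00); rewrite /= B00 W00 eqxx /=.
rewrite (same W X00 X20) ?W00 // conD /= B20 W20 n20 /=.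
rewrite (same B X20 X21) ?B20 //.
have := conD (E X21); rewrite /= B21 W21 n21 /= => <-.
rewrite (same W X21 X01) ?W21 // conD /= B01 W01 n01 /=.
by rewrite (same B X01 X00) ?B01 //; case: (D B _).
Qed.

Lemma decidesF N (D : process -> mp_action N -> bool) : ~ decides D.
Proof.
elim: N D => [|N IH] D; first exact: decides0F.
by move/decides_shrink/IH.
Qed.

Section Views.
Variable N : nat.
Local Notation protocol := (product_update input_model (message_passing N)).

Definition view_pair a (t : mp_action N) :
    vertex input_model * {set action (message_passing N)} :=
  ((a, input_of a t.2), @action_class _ _ (message_passing N) a t).

Lemma view_subproof a t : product_vertex_pred (view_pair a t).
Proof.
exact: (@product_vertexP _ _ _ input_model (message_passing N) (val t.2) t
  (a, input_of a t.2) (valP t.2) (sat_mp_precond t) (input_of_mem a t.2)).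
Qed.

Definition view a t : vertex protocol := Sub (view_pair a t) (view_subproof a t).

Lemma view_indist a s t : mp_indist a s t -> view a s = view a t.
Proof.
move=> st; apply: product_vertex_inj => /=; last first.
  apply/setP=> r; rewrite !inE /=.
  by case: (mp_indist_equiv a s t r) => _ /(_ st).
(* Induction from the last layer: a lost message defers to the earlier layers, a received one forces
   equal input facets. *)
congr pair; case: s t st => al X [be Y].
rewrite /mp_indist /=; elim: (rev al) (rev be) => [|p u IH] [|q v] //=.
  by move/eqP.
by case/orP=> [/and3P[_ _ /IH]|/and4P[_ _ /eqP->]].
Qed.

Lemma view_facet t :
  [set view B t; view W t] \in simplices protocol.
Proof.
rewrite inE; apply/andP; split.
  by apply/set0Pn; exists (view B t); rewrite !inE eqxx.
apply/exists_inP; exists (@product_facet _ _ _ input_model (message_passing N) (val t.2) t).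
  apply/imset2P; exists (val t.2) t => //; first exact: (valP t.2).
  by rewrite inE; exact: sat_mp_precond.
apply/subsetP=> u; rewrite !inE => /orP[] /eqP-> /=.
  by apply/imsetP; exists (B, input_of B t.2); rewrite ?input_of_mem.
by apply/imsetP; exists (W, input_of W t.2); rewrite ?input_of_mem.
Qed.

End Views.

(** The colors force the two vertices to be those of an output facet, whose condition then
    applies. *)
Lemma output_simplex_decision (i j : 'I_3) (d e : bool) :
  [set (B, i, d); (W, j, e)] \in simplices output_model -> e = (i == j) (+) d.
Proof.
rewrite inE => /andP[_ /exists_inP[Z /imset2P[[k d'] [l e'] _]]].
rewrite !inE /= => Hkl -> /subsetP sub.
have := sub (B, i, d); rewrite !inE eqxx => /(_ isT)/orP[] // /eqP[-> ->].
have := sub (W, j, e); rewrite !inE eqxx orbT => /(_ isT)/orP[] // /eqP[-> ->].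
by rewrite (eqP Hkl) {sub Hkl}; case: d' e' => -[].
Qed.

Theorem theorem2 (N : nat) :
  ~ exists delta : morphism (product_update input_model (message_passing N))
                            output_model,
      forall v : vertex (product_update input_model (message_passing N)),
        output_proj (delta v) = product_proj v.
Proof.
case=> delta proj_delta.
apply: (@decidesF N (fun a t => (delta (view a t)).2)); split=> [a s t st|t].
  by rewrite (view_indist st).
(* Compatibility with the projections leaves only the decision bit free. *)
have deltaE a : delta (view a t) = (a, input_of a t.2, (delta (view a t)).2).
  have := proj_delta (view a t); rewrite /output_proj.
  by case: (delta _) => v d /= ->.
apply: output_simplex_decision; rewrite -!deltaE.
have := morphism_simplex delta (view_facet t).
by rewrite imsetU1 imset_set1.
Qed.
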